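(* Let $\mathbb{K}$ be a field, $n \in \mathbb{N}$, and let $X = X_1 \times \cdots \times X_n$, $Y = Y_1 \times \cdots \times Y_n$ with $X_i, Y_i$ finite subsets of $\mathbb{K}$ and $Y_i \subseteq X_i$ for all $i$; let $P := X \setminus Y$. Let $\lambda_1, \ldots, \lambda_n \in \mathbb{N}_0$ and assume that for each $i$, both $X_i$ and $Y_i$ are $\lambda_i$-null. Let $f \in \mathbb{K}[x_1,\ldots,x_n]$ and let $\alpha = (\alpha_1, \ldots, \alpha_n) \in \operatorname{Supp}(f)$ be such that (1) $\alpha_i < |X_i|$ for all $i$; (2) there exists $i$ with $\alpha_i < |X_i| - |Y_i|$; (3) for every monomial $x^\gamma$ appearing in $f$ with $\gamma \neq \alpha$, there exists $i \in \{1,\ldots,n\}$ such that at least one of the following holds: (a) $\gamma_i \in [0, \alpha_i - 1] \cup [\alpha_i + 1, \alpha_i + \lambda_i]$; (b) $\gamma_i \in [\alpha_i + 1, |X_i| - 1]$ and $|X_i| = |Y_i|$; (c) $\gamma_i \in [\alpha_i + 1, |X_i| - 1]$ and there is $j \in \{1,\ldots,n\}$ with $\gamma_j < |X_j| - |Y_j|$. Then there is $\mathbf{z} \in P$ with $f(\mathbf{z}) \neq 0$.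
   Context: $\operatorname{Supp}(f)$ is the set of exponent vectors $\alpha \in \mathbb{N}_0^n$ of monomials $x^\alpha = x_1^{\alpha_1}\cdots x_n^{\alpha_n}$ appearing in $f$ with nonzero coefficient. For integers $a,b$, $[a,b] := \{x \in \mathbb{N}_0 \mid a \le x \le b\}$ (empty if $a>b$). For $\lambda \in \mathbb{N}_0$, a univariate polynomial of degree $\nu$ is $\lambda$-lacunary if all coefficients of $x^k$ with $\nu - \lambda \le k < \nu$ vanish; a finite $A \subseteq \mathbb{K}$ is $\lambda$-null if $\prod_{a \in A}(x-a)$ is $\lambda$-lacunary. *)

(* Defs.v *)
From HB Require Import structures.
From mathcomp Require Import all_boot all_order all_algebra finmap.
From mathcomp.multinomials Require Import mpoly.
Set Implicit Arguments.
Unset Strict Implicit.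
Unset Printing Implicit Defensive.
Import GRing.Theory.
Local Open Scope ring_scope.

(* The degree of p is (size p).-1. The lower bound nu - lam <= k is written
   additively, so that it is the integer inequality even when lam > nu. *)
Definition lacunary (K : fieldType) (lam : nat) (p : {poly K}) : Prop :=
  let nu := (size p).-1 in
  forall k : nat, (nu <= k + lam)%N -> (k < nu)%N -> p`_k = 0.

Definition null_set (K : fieldType) (lam : nat) (A : {fset K}) : Prop :=
  lacunary lam (\prod_(a <- A) ('X - a%:P)).

Definition in_grid (K : fieldType) (n : nat) (X : 'I_n -> {fset K})
    (z : 'I_n -> K) : Prop :=
  forall i, z i \in X i.

(* Main.v *)
(** If [f] vanishes on [P], every linear functional of the form
    [f |-> \sum_(z in P) w z * f z] kills it, so it suffices to find weights
    [w] on the grid [X], zero on [Y], for which this functional picks out the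
    coefficient of [x^alpha].  In one variable, let [g] and [q] be the monic
    polynomials with root sets [X i] and [X i \ Y i].  By Lagrange interpolation
    the coefficient of [x^(alpha i)] in the remainder of [p] modulo [g] is a
    weighted sum of the values of [p] on [X i], with weights [u i]; modulo [q] it
    is one over [X i \ Y i] only, with weights [c i].  Hence [u i] and [u i - c i]
    agree on [Y i], and
    [w z = \prod_i u i (z i) - \prod_i (u i (z i) - c i (z i))] vanishes on [Y].
    The value on [x^gamma] is a difference of two products of coefficients of
    remainders of powers of one variable, and lacunarity of [g], which passes
    to [q], makes it zero for each [gamma] allowed in [f] other than [alpha]. *)
Require Import Defs.
From mathcomp Require Import all_boot all_order all_algebra finmap zify ring.
From mathcomp.multinomials Require Import mpoly.
Import GRing.Theory.
Local Open Scope ring_scope.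

Definition root_poly (K : fieldType) (A : {fset K}) : {poly K} :=
  \prod_(a <- A) ('X - a%:P).

Definition lagrange_num (K : fieldType) (A : {fset K}) (a : K) : {poly K} :=
  root_poly K (A `\ a)%fset.

(** The value 0 off [A] lets the sums for different sets run over one common superset. *)
Definition remainder_weight (K : fieldType) (A : {fset K}) (m : nat) (a : K) : K :=
  if a \in A then (lagrange_num K A a)`_m / (lagrange_num K A a).[a] else 0.

Lemma root_poly_monic (K : fieldType) (A : {fset K}) : root_poly K A \is monic.
Proof. exact: monic_prod_XsubC. Qed.

Lemma size_root_poly (K : fieldType) (A : {fset K}) :
  size (root_poly K A) = #|` A|.+1.
Proof. exact: size_prod_XsubC. Qed.

Lemma root_root_poly (K : fieldType) (A : {fset K}) (x : K) :
  root (root_poly K A) x = (x \in A).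
Proof. exact: root_prod_XsubC. Qed.

Lemma root_polyD (K : fieldType) (A B : {fset K}) :
  (B `<=` A)%fset -> root_poly K A = root_poly K (A `\` B)%fset * root_poly K B.
Proof.
move=> sBA; rewrite /root_poly (big_fsetID _ (mem B)) mulrC /=.
congr (_ * _); apply: eq_fbigl => x; rewrite !inE /=; last by rewrite andbC.
by rewrite andb_idl // => /(fsubsetP sBA).
Qed.

Lemma lagrange_num_other (K : fieldType) (A : {fset K}) (a b : K) :
  b \in A -> a != b -> (lagrange_num K A a).[b] = 0.
Proof.
move=> bA ab; apply/eqP; rewrite -/(root _ b) root_root_poly !inE bA andbT.
by rewrite eq_sym.
Qed.

Lemma lagrange_num_self (K : fieldType) (A : {fset K}) (a : K) :
  (lagrange_num K A a).[a] != 0.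
Proof. by rewrite -/(root _ a) root_root_poly !inE eqxx. Qed.

(** The difference of the two sides has size at most the cardinality of [A] and vanishes on [A];
    were it nonzero, it would have too many roots. *)
Lemma modp_lagrange (K : fieldType) (A : {fset K}) (p : {poly K}) :
  p %% root_poly K A =
  \sum_(a <- A) (p.[a] / (lagrange_num K A a).[a]) *: lagrange_num K A a.
Proof.
apply/eqP; rewrite -subr_eq0; apply/negPn/negP => nz.
set s := \sum_(a <- A) _ in nz.
have sz : (size (p %% root_poly K A - s)%R <= #|` A|)%N.
  apply: leq_trans (size_polyD _ _) _; rewrite geq_max size_polyN; apply/andP; split.
    by rewrite -ltnS -(size_root_poly K A) ltn_modp monic_neq0 ?root_poly_monic.
  rewrite /s big_seq; elim/big_ind: _ => [|x y hx hy|a aA]; first by rewrite size_poly0.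
    by apply: leq_trans (size_polyD _ _) _; rewrite geq_max hx.
  apply: leq_trans (size_scale_leq _ _) _.
  by rewrite size_root_poly [X in (_ <= X)%N](cardfsD1 a) aA.
suff /(max_poly_roots nz)/(_ (fset_uniq A)) : all (root (p %% root_poly K A - s)) A.
  by rewrite ltnNge sz.
apply/allP => b bA; rewrite /root !hornerE.
have -> : (p %% root_poly K A).[b] = p.[b].
  rewrite {2}(divp_eq p (root_poly K A)) !hornerE.
  by have /eqP -> : root (root_poly K A) b; rewrite ?root_root_poly // mulr0 add0r.
rewrite /s horner_sum (big_fsetD1 b) //= big_seq big1 => [|a].
  by rewrite addr0 hornerZ divfK ?lagrange_num_self // subrr.
by rewrite !inE => /andP[ab aA]; rewrite hornerZ (lagrange_num_other _ _ a b) ?mulr0.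
Qed.

Lemma coef_modp_weight (K : fieldType) (A S : {fset K}) (m : nat) (p : {poly K}) :
  (A `<=` S)%fset ->
  (p %% root_poly K A)`_m =
  \sum_(a : S) remainder_weight K A m (val a) * p.[val a].
Proof.
move=> sAS.
rewrite -(big_seq_fsetE _ S predT (fun a => remainder_weight K A m a * p.[a])) /=.
rewrite -(big_fset_incl _ sAS) => [|x _ xA]; last first.
  by rewrite /remainder_weight (negbTE xA) mul0r.
rewrite modp_lagrange coef_sum !big_seq; apply: eq_bigr => a aA.
by rewrite coefZ /remainder_weight aA [RHS]mulrC mulrAC mulrA.
Qed.

(* Subtraction is truncated, so [lam > #|A|] forces [root_poly A] to be a power of ['X]. *)
Definition gap (K : fieldType) (lam : nat) (A : {fset K}) : Prop :=
  (size (root_poly K A - 'X^(#|` A|))%R <= #|` A| - lam)%N.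

Lemma null_set_gap (K : fieldType) (lam : nat) (A : {fset K}) :
  null_set lam A -> gap K lam A.
Proof.
rewrite /null_set /lacunary -/(root_poly K A) size_root_poly succnK => h.
apply/leq_sizeP => j hj; rewrite coefB coefXn.
have [lt|gt|->] := ltngtP j #|` A|.
- by rewrite h ?subr0 //; lia.
- by rewrite nth_default ?subr0 // size_root_poly.
- have := root_poly_monic K A.
  by rewrite monicE /lead_coef size_root_poly /= => /eqP ->; rewrite subrr.
Qed.

(** Let [q] and [h] be the root polynomials of the difference and of [B], of degrees [d] and [M].
    The identity [(q - 'X^d) * h = (q * h - 'X^(d + M)) - (h - 'X^M) * 'X^d] bounds the size of its
    left side, and the monic [h] contributes exactly [M] to that size. *)
Lemma gapD (K : fieldType) (lam : nat) (A B : {fset K}) :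
  (B `<=` A)%fset -> gap K lam A -> gap K lam B -> gap K lam (A `\` B)%fset.
Proof.
move=> sBA; rewrite /gap (root_polyD _ _ _ sBA).
have -> : #|` A| = (#|` (A `\` B)%fset| + #|` B|)%N.
  by rewrite cardfsDS // subnK ?fsubset_leq_card.
set q := root_poly K (A `\` B)%fset; set h := root_poly K B.
set d := #|` _ |; set M := #|` B| => hA hB.
have [->|nz] := eqVneq (q - 'X^d) 0; first by rewrite size_poly0.
have /(congr1 (fun p : {poly K} => size p)) :
    (q - 'X^d) * h = (q * h - 'X^(d + M)) - (h - 'X^M) * 'X^d.
  by rewrite exprD; ring.
rewrite size_Mmonic ?root_poly_monic // size_root_poly -/M addnS /= => eq.
have := size_polyD (q * h - 'X^(d + M)) (- ((h - 'X^M) * 'X^d)).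
rewrite size_polyN -eq.
(* Positivity is what turns a bound by the truncated [d + M - lam] into one by [d - lam]. *)
have : (0 < size (q - 'X^d)%R)%N by rewrite size_poly_gt0.
clear eq nz; move: hA hB.
set a := size (q - 'X^d); set b := size (q * h - _).
have [->|nz'] := eqVneq (h - 'X^M) 0; first by rewrite mul0r size_poly0; lia.
have : (0 < size (h - 'X^M)%R)%N by rewrite size_poly_gt0.
rewrite size_mulXn //; set e := size (h - _); lia.
Qed.

Lemma coef_modXn_small (K : fieldType) (A : {fset K}) (m k : nat) :
  (k < #|` A|)%N -> ('X^k %% root_poly K A)`_m = (m == k)%:R.
Proof. by move=> kA; rewrite modp_small ?coefXn // size_polyXn size_root_poly. Qed.

Lemma coef_modXn_lt (K : fieldType) (A : {fset K}) (m k : nat) :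
  (k < m)%N -> ('X^k %% root_poly K A)`_m = 0.
Proof.
move=> km; rewrite nth_default //.
by apply: leq_trans (leq_modp _ _) _; rewrite size_polyXn.
Qed.

Lemma coef_modXn_ge (K : fieldType) (A : {fset K}) (m k : nat) :
  (#|` A| <= m)%N -> ('X^k %% root_poly K A)`_m = 0.
Proof.
move=> Am; rewrite nth_default //; apply: leq_trans Am.
by rewrite -ltnS -(size_root_poly K A) ltn_modp monic_neq0 ?root_poly_monic.
Qed.

(** If [k] is below the degree [N] of [g], ['X^k] is its own remainder. Otherwise ['X^k] is
    congruent to [- (g - 'X^N) * 'X^(k - N)], whose size is at most [k - lam <= m]. *)
Lemma coef_modXn_gap (K : fieldType) (lam : nat) (A : {fset K}) (m k : nat) :
  gap K lam A -> (m < k <= m + lam)%N -> ('X^k %% root_poly K A)`_m = 0.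
Proof.
rewrite /gap; set g := root_poly K A; set N := #|` A| => gA mk.
have [kN|Nk] := ltnP k N; first by rewrite coef_modXn_small //; case: eqP => //; lia.
have -> : 'X^k = 'X^(k - N) * g - (g - 'X^N) * 'X^(k - N) :> {poly K}.
  by rewrite [_ * g]mulrC -mulrBl subKr -exprD subnKC.
rewrite modpD modp_mull add0r nth_default //.
apply: leq_trans (leq_modp _ _) _; rewrite size_polyN.
have [->|nz] := eqVneq (g - 'X^N) 0; first by rewrite mul0r size_poly0.
have : (0 < size (g - 'X^N)%R)%N by rewrite size_poly_gt0.
rewrite size_mulXn //; move: gA; set e := size (g - _); lia.
Qed.

(** On each monomial, a sum of product weights over the grid factors into one-variable sums. *)
Lemma sum_prod_weight_meval (K : fieldType) (n : nat) (S : finType) (v : S -> K)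
    (w : 'I_n -> S -> K) (f : {mpoly K[n]}) :
  \sum_(z : {ffun 'I_n -> S}) (\prod_i w i (z i)) * f.@[fun i => v (z i)] =
  \sum_(m <- msupp f) f@_m * \prod_i \sum_(a : S) w i a * v a ^+ m i.
Proof.
under eq_bigr do rewrite mevalE big_distrr /=.
rewrite exchange_big /=; apply: eq_bigr => m _.
rewrite bigA_distr_bigA big_distrr /=; apply: eq_bigr => z _.
by rewrite mulrCA big_split.
Qed.

Theorem theorem2p4 (K : fieldType) (n : nat) (hn : (0 < n)%N)
    (X Y : 'I_n -> {fset K})
    (hYX : forall i, (Y i `<=` X i)%fset)
    (lam : 'I_n -> nat)
    (hX : forall i, null_set (lam i) (X i))
    (hY : forall i, null_set (lam i) (Y i))
    (f : {mpoly K[n]}) (alpha : 'X_{1..n})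
    (halpha : alpha \in msupp f)
    (h1 : forall i, (alpha i < #|` X i|)%N)
    (h2 : exists i, (alpha i < #|` X i| - #|` Y i|)%N)
    (h3 : forall gamma : 'X_{1..n}, gamma \in msupp f -> gamma <> alpha ->
      exists i : 'I_n,
        [\/ (gamma i < alpha i)%N \/
              (alpha i + 1 <= gamma i <= alpha i + lam i)%N,
            (alpha i + 1 <= gamma i < #|` X i|)%N /\ #|` X i| = #|` Y i|
          | (alpha i + 1 <= gamma i < #|` X i|)%N /\
              exists j : 'I_n, (gamma j < #|` X j| - #|` Y j|)%N]) :
  exists z : 'I_n -> K, [/\ in_grid X z, ~ in_grid Y z & f.@[z] <> 0].
Proof.
pose Q i := (X i `\` Y i)%fset.
have cQ i : #|` Q i| = (#|` X i| - #|` Y i|)%N by rewrite cardfsDS.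
have gX i : gap K (lam i) (X i) by apply: null_set_gap.
have gQ i : gap K (lam i) (Q i) by apply: gapD => //; apply: null_set_gap.
(* A common alphabet [S] makes the points a finite type of functions; weights vanish off the actual
   grid. *)
pose S := (\bigcup_(i <- enum 'I_n) X i)%fset.
have XS i : (X i `<=` S)%fset by apply: bigfcup_sup; rewrite ?mem_enum.
have QS i : (Q i `<=` S)%fset by apply: fsubset_trans (XS i); apply: fsubsetDl.
pose u i (a : S) := remainder_weight K (X i) (alpha i) (val a).
pose c i (a : S) := remainder_weight K (Q i) (alpha i) (val a).
pose A i k := ('X^k %% root_poly K (X i))`_(alpha i).
pose C i k := ('X^k %% root_poly K (Q i))`_(alpha i).
have uE i k : \sum_(a : S) u i a * val a ^+ k = A i k.
  by rewrite /A (coef_modp_weight K _ S) //; apply: eq_bigr => a _; rewrite hornerXn.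
have cE i k : \sum_(a : S) c i a * val a ^+ k = C i k.
  by rewrite /C (coef_modp_weight K _ S) //; apply: eq_bigr => a _; rewrite hornerXn.
have ucE i k : \sum_(a : S) (u i a - c i a) * val a ^+ k = A i k - C i k.
  by under eq_bigr do rewrite mulrBl; rewrite sumrB uE cE.
(* Here ['X^k] is its own remainder modulo both polynomials. *)
have lowAC i k : (k < #|` X i| - #|` Y i|)%N -> A i k - C i k = 0.
  by move=> kd; rewrite /A /C !coef_modXn_small ?subrr ?cQ //; lia.
pose w (z : {ffun 'I_n -> S}) := \prod_i u i (z i) - \prod_i (u i (z i) - c i (z i)).
have Lalpha : \prod_i A i (alpha i) - \prod_i (A i (alpha i) - C i (alpha i)) = 1.
  have [i0 hi0] := h2.
  rewrite big1 => [|i _]; last by rewrite /A coef_modXn_small ?eqxx.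
  by rewrite (bigD1 i0) //= lowAC // mul0r subr0.
have Lgamma (g : 'X_{1..n}) : g \in msupp f -> g != alpha ->
    \prod_i A i (g i) - \prod_i (A i (g i) - C i (g i)) = 0.
  move=> gf /eqP /(h3 g gf)[i hi].
  (* One zero factor in each product suffices, and the two indices may differ. *)
  suff [A0 [j AC0]] : A i (g i) = 0 /\ exists j, A j (g j) - C j (g j) = 0.
    by rewrite (bigD1 i) //= A0 mul0r (bigD1 j) //= AC0 mul0r subr0.
  have mid : (alpha i + 1 <= g i < #|` X i|)%N -> A i (g i) = 0.
    move=> /andP[lo hi']; rewrite /A coef_modXn_small //.
    by case: eqP lo => // ->; lia.
  case: hi => [[lt|/andP[lo hi]]|[/mid A0 eqXY]|[/mid A0 [j hj]]].
  - by rewrite /A coef_modXn_lt //; split=> //; exists i; rewrite /C !coef_modXn_lt ?subrr.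
  - have lohi : (alpha i < g i <= alpha i + lam i)%N by lia.
    rewrite /A (coef_modXn_gap _ _ _ _ _ (gX i)) //; split=> //; exists i.
    by rewrite /C (coef_modXn_gap _ _ _ _ _ (gX i)) ?(coef_modXn_gap _ _ _ _ _ (gQ i)) ?subrr.
  (* Equal cardinalities make [Q i] empty, so every remainder modulo its root polynomial 1 is
     zero. *)
  - split=> //; exists i; rewrite A0 /C coef_modXn_ge ?subrr //.
    by rewrite cQ eqXY subnn.
  - by split=> //; exists j; apply: lowAC.
have LE : \sum_z w z * f.@[fun i => val (z i)] = f@_alpha.
  under eq_bigr do rewrite mulrBl.
  rewrite sumrB sum_prod_weight_meval.
  rewrite (sum_prod_weight_meval _ _ S val (fun i a => u i a - c i a)).
  rewrite -sumrB (bigD1_seq alpha) //=.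
  rewrite -mulrBr; under [\prod_i \sum_a u _ _ * _]eq_bigr do rewrite uE.
  under [\prod_i \sum_a (_ - _) * _]eq_bigr do rewrite ucE.
  rewrite Lalpha mulr1 big_seq_cond big1 ?addr0 // => m /andP[mf ma].
  under eq_bigr do rewrite uE.
  under [\prod_i \sum_a (_ - _) * _]eq_bigr do rewrite ucE.
  by rewrite -mulrBr Lgamma ?mulr0.
have [z nz] : exists z : {ffun 'I_n -> S}, w z * f.@[fun i => val (z i)] != 0.
  apply/existsP; apply/contraT; rewrite negb_exists => /forallP h.
  move: halpha; rewrite mcoeff_msupp -LE big1 ?eqxx // => z _.
  by apply/eqP; have := h z; rewrite negbK.
move: nz; rewrite mulf_eq0 negb_or => /andP[wz /eqP fz].
exists (fun i => val (z i)); split=> // [i|zY].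
(* A coordinate outside [X i] has [u] and [c] both zero, which kills both products. *)
- apply: contraNT wz => zX.
  have u0 : u i (z i) = 0 by rewrite /u /remainder_weight (negbTE zX).
  have c0 : c i (z i) = 0 by rewrite /c /remainder_weight !inE (negbTE zX) andbF.
  by rewrite /w (bigD1 i) //= [X in _ - X](bigD1 i) //= c0 u0 subr0 !mul0r subr0.
(* On [Y] every [c i (z i)] is zero, so the two products in [w z] cancel. *)
- move: wz; rewrite /w [X in _ - X](_ : _ = \prod_i u i (z i)) ?subrr ?eqxx //.
  apply: eq_bigr => i _.
  by rewrite [c _ _]/remainder_weight !inE zY subr0.
Qed.
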